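(* Let $L_n$ denote either of the two fractions $L_{E,n}$, $L_{R,n}$, and let the constants below be defined with respect to that $L_n$. Then for all $\varepsilon,\gamma>0$: $$\underline{C_{AE}}(g_0,\varepsilon,\gamma)\ge\frac1{2\sqrt{2\pi}},$$ $$\sup_{g\in\mathcal G}\overline{C_{AE}}(g,\varepsilon,\gamma)=\overline{C_{AE}}(g_0,\varepsilon,\gamma)\ge\overline{C_{AE}}^{\,cond}(g_0,\varepsilon,\gamma)\ge\frac1{2\min\{\varepsilon,1\}},$$ $$\inf_{g\in\mathcal G}\overline{C_{AE}}(g,\varepsilon,\gamma)=\overline{C_{AE}}(g_1,\varepsilon,\gamma)\ge\overline{C_{AE}}^{\,cond}(g_1,\varepsilon,\gamma)\ge\begin{cases}0.5,&\varepsilon\le1,\\ e^{-\varepsilon^{-2}}I_0(\varepsilon^{-2})/2,&1<\varepsilon\le1.1251,\\ 0.2344,&\varepsilon\ge1.1251,\end{cases}$$ where $I_0(z)=\sum_{k=0}^\infty(z/2)^{2k}/(k!)^2$ is the modified Bessel function of order zero.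
   Context: $\Phi$ is the standard normal distribution function. Let $\mathcal F$ be the set of non-degenerate distribution functions with zero mean and finite second moment. For $F\in\mathcal F$ let $X_1,\dots,X_n$ be i.i.d. with distribution function $F$, $\sigma_1^2={\sf E}X_1^2$, $B_n^2=n\sigma_1^2$, $S_n=X_1+\dots+X_n$, $\Delta_n(F)=\sup_x|{\sf P}(S_n/B_n<x)-\Phi(x)|$, $\mu_1(z)={\sf E}X_1^3\mathbf 1(|X_1|<z)$, $\sigma_1^2(z)={\sf E}X_1^2\mathbf 1(|X_1|\ge z)$, $M_n(z)=nB_n^{-3}\mu_1(zB_n)$, $L_n(z)=nB_n^{-2}\sigma_1^2(zB_n)$. Let $\mathcal G$ be the set of non-decreasing $g:[0,\infty)\to[0,\infty)$ with $g(z)>0$ for $z>0$ and $z/g(z)$ non-decreasing on $(0,\infty)$. For $g\in\mathcal G$, $\varepsilon,\gamma>0$: $L_{E,n}(g,\varepsilon,\gamma)=\sup_{0<z<\varepsilon}\frac{g(zB_n)}{zg(B_n)}(\gamma|M_n(z)|+zL_n(z))$ and $L_{R,n}(g,\varepsilon,\gamma)=\gamma\frac{g(\varepsilon B_n)}{\varepsilon g(B_n)}|M_n(\varepsilon)|+\sup_{0<z<\varepsilon}\frac{g(zB_n)}{g(B_n)}L_n(z)$ (both depending also on $F$). Here $g_0(z)=\min\{z,B_n\}$ and $g_1(z)=\max\{z,B_n\}$. For $L_n\in\{L_{E,n},L_{R,n}\}$ define the upper asymptotically exact constant $\overline{C_{AE}}(g,\varepsilon,\gamma)=\limsup_{n\to\infty}\sup_{F\in\mathcal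 F}\Delta_n(F)/L_n(g,\varepsilon,\gamma)$, the lower asymptotically exact constant $\underline{C_{AE}}(g,\varepsilon,\gamma)=\limsup_{\ell\to0}\limsup_{n\to\infty}\sup_{F\in\mathcal F:\,L_n(g,\varepsilon,\gamma)=\ell}\Delta_n(F)/\ell$, and the conditional upper asymptotically exact constant $\overline{C_{AE}}^{\,cond}(g,\varepsilon,\gamma)=\sup_{\ell>0}\limsup_{n\to\infty}\sup_{F\in\mathcal F:\,L_n(g,\varepsilon,\gamma)=\ell}\Delta_n(F)/\ell$. *)

(* Defs.v *)
From HB Require Import structures.
From mathcomp Require Import all_boot all_order all_algebra.
From mathcomp Require Import all_classical all_reals all_analysis.
Set Implicit Arguments. Unset Strict Implicit. Unset Printing Implicit Defensive.
Import Order.TTheory GRing.Theory Num.Theory.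
Import numFieldNormedType.Exports.
Local Open Scope classical_set_scope.
Local Open Scope ring_scope.

Section Defs.
Variable R : realType.

Definition law := probability R R.

(** P(S_n < x) for S_n = X_1 + ... + X_n, X_i i.i.d. with law mu,
    computed through the convolution recursion
    P(S_0 < x) = 1(0 < x),  P(S_{n+1} < x) = E P(S_n < x - X_{n+1}). *)
Fixpoint cdf_lt (mu : law) (n : nat) (x : R) : R :=
  match n with
  | O => if 0 < x then 1 else 0
  | S k => Rintegral mu setT (fun y => cdf_lt mu k (x - y))
  end.

Definition Phi (x : R) : R := fine (normal_prob 0 1 `]-oo, x[).

Definition mean (mu : law) : \bar R := (\int[mu]_x x%:E)%E.
Definition second_moment (mu : law) : \bar R := (\int[mu]_x (x ^+ 2)%:E)%E.

Definition in_F (mu : law) : Prop :=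
  (~ exists a : R, mu [set a] = 1%E) /\
  mu.-integrable setT (fun x => (x ^+ 2)%:E) /\
  mean mu = 0%E.

Definition sigma1sq (mu : law) : R := fine (second_moment mu).
Definition Bn (mu : law) (n : nat) : R := Num.sqrt (n%:R * sigma1sq mu).

Definition mu1 (mu : law) (z : R) : R :=
  Rintegral mu [set x | `|x| < z] (fun x => x ^+ 3).
Definition sigma1sq_tail (mu : law) (z : R) : R :=
  Rintegral mu [set x | z <= `|x|] (fun x => x ^+ 2).

Definition Mn (mu : law) (n : nat) (z : R) : R :=
  n%:R / (Bn mu n) ^+ 3 * mu1 mu (z * Bn mu n).
Definition Ln (mu : law) (n : nat) (z : R) : R :=
  n%:R / (Bn mu n) ^+ 2 * sigma1sq_tail mu (z * Bn mu n).

Definition Delta (mu : law) (n : nat) : R :=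
  sup [set `|cdf_lt mu n (x * Bn mu n) - Phi x| | x in [set: R]].

Definition in_G (g : R -> R) : Prop :=
  (forall x y, 0 <= x -> x <= y -> g x <= g y) /\
  (forall z, 0 <= z -> 0 <= g z) /\
  (forall z, 0 < z -> 0 < g z) /\
  (forall x y, 0 < x -> x <= y -> x / g x <= y / g y).

Definition L_E (mu : law) (n : nat) (g : R -> R) (eps gam : R) : R :=
  sup [set g (z * Bn mu n) / (z * g (Bn mu n)) *
             (gam * `|Mn mu n z| + z * Ln mu n z) | z in `]0, eps[].
Definition L_R (mu : law) (n : nat) (g : R -> R) (eps gam : R) : R :=
  gam * (g (eps * Bn mu n) / (eps * g (Bn mu n))) * `|Mn mu n eps| +
  sup [set g (z * Bn mu n) / g (Bn mu n) * Ln mu n z | z in `]0, eps[].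

Inductive Lkind := LE | LR.
Definition Lfrac (k : Lkind) := match k with LE => L_E | LR => L_R end.

(** A function g in G may depend on n and on F (through B_n), as g_0, g_1 do. *)
Definition gfam := law -> nat -> R -> R.
Definition g0 : gfam := fun mu n z => Num.min z (Bn mu n).
Definition g1 : gfam := fun mu n z => Num.max z (Bn mu n).
Definition in_Gfam (g : gfam) : Prop := forall mu n, in_G (g mu n).

Local Open Scope ereal_scope.

Definition C_up (k : Lkind) (g : gfam) (eps gam : R) : \bar R :=
  limn_esup (fun n => ereal_sup
    [set ((Delta mu n / Lfrac k mu n (g mu n) eps gam)%R)%:E | mu in in_F]).

Definition C_at (k : Lkind) (g : gfam) (eps gam l : R) : \bar R :=
  limn_esup (fun n => ereal_sup
    [set ((Delta mu n / l)%R)%:E |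
      mu in [set mu | in_F mu /\ Lfrac k mu n (g mu n) eps gam = l]]).

Definition C_low (k : Lkind) (g : gfam) (eps gam : R) : \bar R :=
  limf_esup (fun l : R => C_at k g eps gam l) ((0:R)%R^'+).

Definition C_cond (k : Lkind) (g : gfam) (eps gam : R) : \bar R :=
  ereal_sup [set C_at k g eps gam l | l in [set l : R | (0 < l)%R]].

Definition supG (k : Lkind) (eps gam : R) : \bar R :=
  ereal_sup [set C_up k g eps gam | g in in_Gfam].
Definition infG (k : Lkind) (eps gam : R) : \bar R :=
  ereal_inf [set C_up k g eps gam | g in in_Gfam].

Local Close Scope ereal_scope.

Definition I0 (z : R) : R :=
  limn (fun N => \sum_(0 <= k < N) (z / 2) ^+ (2 * k) / (k`!)%:R ^+ 2).

End Defs.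

(* Main.v *)
(** For [g] in G the ratio [g (z B_n) / g B_n] lies between [min z 1] and
    [max z 1], which are its values for [g0] and [g1]; so both fractions are
    extremal at [g0] and [g1], and the sup/inf identities follow.

    All the lower bounds are obtained from symmetric laws with atoms at
    0, +-b1, +-b2, normalised so that B_n = 1.  Then M_n = 0 and L_n is a step
    function, so that the fractions are explicit, and two estimates suffice.
    The jump of P(S_n < x) at 0 gives Delta_n >= P(X_1 = 0)^n / 2: this is close
    to 1/2 when b1 = b2 is large, and b1 = 1, b2 = 2 with equal variances give a
    fraction equal to 1 and Delta_n >= (11/16)^2 / 2 > 0.2344 for every eps.
    When b1 = b2 = b is small, P(S_n < x) is constant on ]0, b] while Phi
    increases by about b / sqrt (2 pi), so Delta_n >= b / (2 sqrt (2 pi)) up to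
    lower order terms.  On 1 < eps <= 1.1251 the bound with the Bessel function
    is weaker than the bound 1 / (2 eps) given by large b. *)
Require Import Defs.
From HB Require Import structures.
From mathcomp Require Import all_boot all_order all_algebra.
From mathcomp Require Import all_classical all_reals all_analysis measurable_realfun.
From mathcomp Require Import ring lra.
Import Order.TTheory GRing.Theory Num.Theory.
Local Open Scope ring_scope.
Set Implicit Arguments. Unset Strict Implicit. Unset Printing Implicit Defensive.
Import numFieldNormedType.Exports.
Local Open Scope classical_set_scope.

(** * Finitely supported laws and the distribution functions of their sums *)

Section DiscreteLaw.
Variables (R : realType) (m : nat) (w : nat -> {nonneg R}) (x : nat -> R).
Hypothesis sum_w : \sum_(i < m) (w i)%:num = 1.

Definition discrete_law : set R -> \bar R :=
  msum (fun i => mscale (w i) \d_(x i)) m.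

HB.instance Definition _ := Measure.on discrete_law.

Let discrete_law_setT : discrete_law [set: R] = 1%E.
Proof.
rewrite /discrete_law /msum -sum_w -sumEFin.
by apply: eq_bigr => i _; rewrite /= /mscale/= diracT mule1.
Qed.

HB.instance Definition _ :=
  Measure_isProbability.Build _ _ R discrete_law discrete_law_setT.

Lemma discrete_law1 (a : R) :
  discrete_law [set a] = (\sum_(i < m) (w i)%:num * (x i == a)%:R)%:E.
Proof.
rewrite /discrete_law /msum -sumEFin.
apply: eq_bigr => i _; rewrite /= /mscale/= diracE.
by have -> : (x i \in [set a]%classic) = (x i == a) by apply/idP/eqP; rewrite inE.
Qed.

Let ge0_integral_discrete (f : R -> R) :
  measurable_fun setT f -> (forall t, 0 <= f t) ->
  (\int[discrete_law]_t (f t)%:E = (\sum_(i < m) (w i)%:num * f (x i))%:E)%E.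
Proof.
move=> mf f0.
have mf' : measurable_fun setT (fun t : R => (f t)%:E) by exact/measurable_EFinP.
rewrite ge0_integral_measure_sum//; last by move=> t _; rewrite lee_fin.
rewrite -sumEFin; apply: eq_bigr => i _.
rewrite ge0_integral_mscale//; last by move=> t _; rewrite lee_fin.
by rewrite integral_dirac// diracT mul1e.
Qed.

Lemma integrable_discrete (f : R -> R) :
  measurable_fun setT f ->
  (discrete_law : measure _ _).-integrable setT (fun t => (f t)%:E).
Proof.
move=> mf; apply/integrableP; split; first exact/measurable_EFinP.
rewrite (ge0_integral_discrete (f := fun t => `|f t|))//; first by rewrite ltry.
exact: measurableT_comp.
Qed.

Lemma integral_discrete (f : R -> R) :
  measurable_fun setT f ->
  (\int[discrete_law]_t (f t)%:E = (\sum_(i < m) (w i)%:num * f (x i))%:E)%E.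
Proof.
move=> mf; rewrite integralE (funerpos f) (funerneg f).
rewrite !ge0_integral_discrete//; last 2 first.
  exact: measurable_funrneg.
  exact: measurable_funrpos.
rewrite -EFinB -sumrB; congr EFin; apply: eq_bigr => i _.
by rewrite -mulrBr; congr (_ * _); exact: (congr1 (@^~ (x i)) (funrposBneg f)).
Qed.

Lemma Rintegral_discrete (D : set R) (f : R -> R) :
  measurable D -> measurable_fun setT f ->
  Rintegral (discrete_law : measure _ _) D f = \sum_(i < m) (w i)%:num * (f \_ D) (x i).
Proof.
move=> mD mf; rewrite Rintegral_mkcond /Rintegral integral_discrete//.
by apply/(measurable_restrictT _ mD)/measurable_funTS.
Qed.

Definition discrete_prob : law R := discrete_law.

Local Notation law := discrete_prob.

(** Both parts go together: turning the convolution integral into a finite sum requires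
    measurability at rank k, and that finite sum in turn gives measurability at rank k+1. *)
Lemma cdf_lt_discrete k : measurable_fun setT (cdf_lt law k) /\
  forall t, cdf_lt law k.+1 t = \sum_(i < m) (w i)%:num * cdf_lt law k (t - x i).
Proof.
have rec n : measurable_fun setT (cdf_lt law n) -> forall t,
    cdf_lt law n.+1 t = \sum_(i < m) (w i)%:num * cdf_lt law n (t - x i).
  move=> mn t; rewrite /= Rintegral_discrete//; last first.
    by apply: measurableT_comp => //; exact: measurable_funB.
  by apply: eq_bigr => i _; rewrite patch_setT.
suff mk : measurable_fun setT (cdf_lt law k) by split=> //; exact: rec.
elim: k => [|k IH].
  rewrite (_ : cdf_lt law 0 = \1_(`]0, +oo[%classic : set R)).
    exact: measurable_indic.
  apply/funext => t; rewrite /= indicE; case: ifPn => t0.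
    by rewrite mem_set//= in_itv/= t0.
  by rewrite memNset//= in_itv/= andbT; exact/negP.
rewrite (_ : cdf_lt law k.+1 =
    fun t => \sum_(i < m) (w i)%:num * cdf_lt law k (t - x i)); last first.
  by apply/funext => t; exact: rec.
apply: measurable_sum => i; apply: measurable_funM => //.
by apply: measurableT_comp => //; exact: measurable_funB.
Qed.

Let cdf_ltS k t : cdf_lt law k.+1 t = \sum_(i < m) (w i)%:num * cdf_lt law k (t - x i).
Proof. exact: (cdf_lt_discrete k).2. Qed.

Lemma cdf_lt_discrete_itv k t : 0 <= cdf_lt law k t <= 1.
Proof.
elim: k t => [t|k IH t]; first by rewrite /=; case: ifP; rewrite ?lexx ler01.
rewrite cdf_ltS; apply/andP; split.
  by apply: sumr_ge0 => i _; rewrite mulr_ge0//; case/andP: (IH (t - x i)).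
rewrite -sum_w; apply: ler_sum => i _.
by rewrite ler_piMr//; case/andP: (IH (t - x i)).
Qed.

Lemma cdf_lt_discrete_le k s t : s <= t -> cdf_lt law k s <= cdf_lt law k t.
Proof.
elim: k s t => [s t st|k IH s t st].
  rewrite /=; case: ifPn => s0; last by case: ifP.
  by rewrite (lt_le_trans s0 st).
rewrite !cdf_ltS; apply: ler_sum => i _; apply: ler_wpM2l => //.
by apply: IH; rewrite lerB.
Qed.

(** The jump at 0 is at least the probability that every summand vanishes: the recursion keeps its
    j-th term, and the other terms are nonnegative by monotonicity. *)
Lemma cdf_lt_discrete_jump (j : 'I_m) k t : x j = 0 -> 0 < t ->
  (w j)%:num ^+ k <= cdf_lt law k t - cdf_lt law k 0.
Proof.
move=> xj0 t0; elim: k => [|k IH].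
  by rewrite expr0 /= t0 ltxx subr0.
rewrite !cdf_ltS -sumrB (bigD1 j)//= xj0 !subr0 -mulrBr exprS.
rewrite -[leLHS]addr0 lerD ?ler_wpM2l//.
apply: sumr_ge0 => i _; rewrite -mulrBr mulr_ge0// subr_ge0.
by apply: cdf_lt_discrete_le; rewrite lerB// ltW.
Qed.

(** The sum lives on the lattice of multiples of b, so P(S_k < .) is constant between consecutive
    lattice points. The cells are open on the left because the inequality in P(S_k < t) is strict; q
    is general in the induction since each summand shifts the cell. *)
Lemma cdf_lt_discrete_lattice (b : R) (z : nat -> int) k (q : int) s t : 0 < b ->
  (forall i, (i < m)%N -> x i = (z i)%:~R * b) ->
  q%:~R * b < s -> s <= (q + 1)%:~R * b -> q%:~R * b < t -> t <= (q + 1)%:~R * b ->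
  cdf_lt law k s = cdf_lt law k t.
Proof.
move=> b0 xz; elim: k q s t => [|k IH] q s t qs sq qt tq.
  suff pos u : q%:~R * b < u -> u <= (q + 1)%:~R * b -> (0 < u) = (0 <= q).
    by rewrite /= !pos.
  move=> qu uq; apply/idP/idP => [u0|q0].
    rewrite -ltzD1 -(ltr0z R) -(pmulr_lgt0 _ b0); exact: lt_le_trans uq.
  by apply: le_lt_trans qu; rewrite mulr_ge0 ?(ltW b0)// ler0z.
rewrite !cdf_ltS; apply: eq_bigr => i _; congr (_ * _).
have shift u : u - x i - (q - z i)%:~R * b = u - q%:~R * b.
  by rewrite xz// rmorphB/=; ring.
have shift1 u : (q - z i + 1)%:~R * b - (u - x i) = (q + 1)%:~R * b - u.
  by rewrite xz// !rmorphD/= rmorphN/=; ring.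
apply: (IH (q - z i)).
- by rewrite -subr_gt0 shift subr_gt0.
- by rewrite -subr_ge0 shift1 subr_ge0.
- by rewrite -subr_gt0 shift subr_gt0.
- by rewrite -subr_ge0 shift1 subr_ge0.
Qed.

End DiscreteLaw.

(** * Increments of the normal distribution function *)

Section NormalCdf.
Variable R : realType.

Lemma Phi_itv (t : R) : 0 <= Phi t <= 1.
Proof.
rewrite /Phi; have P1 : (normal_prob 0 1 `]-oo, t[ <= 1)%E by exact: probability_le1.
have P0 : (0 <= normal_prob 0 1 `]-oo, t[)%E by exact: measure_ge0.
by rewrite -!lee_fin fineK ?P0// ge0_fin_numE// (le_lt_trans P1) ?ltry.
Qed.

Lemma PhiB (s t : R) : s <= t ->
  Phi t - Phi s = fine (normal_prob 0 1 `[s, t[).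
Proof.
move=> st; have fin (A : set R) : measurable A -> normal_prob (0 : R) 1 A \is a fin_num.
  by move=> mA; exact: fin_num_measure.
rewrite /Phi (_ : `]-oo, t[%classic = `]-oo, s[ `|` `[s, t[); last first.
  by rewrite -itv_bndbnd_setU// bnd_simp.
rewrite measureU//; last first.
  rewrite -subset0 => u /=; rewrite !in_itv/= => -[us /andP[su _]].
  by move: (lt_le_trans us su); rewrite ltxx.
by rewrite fineD ?fin// addrAC subrr add0r.
Qed.

(** The normal density decreases on the positive half-line, so on [s, t[ it lies between its value
    at t and its peak. *)
Lemma PhiB_bounds (s t : R) : 0 <= s -> s <= t ->
  normal_peak 1 * expR (- (t ^+ 2 / 2)) * (t - s) <= Phi t - Phi s <=
  normal_peak 1 * (t - s).
Proof.
move=> s0 st; rewrite PhiB// -!lee_fin fineK; last exact: fin_num_measure.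
have lenE (c : R) : (\int[lebesgue_measure]_(x in `[s, t[) c%:E = (c * (t - s))%:E)%E.
  rewrite integral_cst//= lebesgue_measure_itv/= lte_fin; case: ltP => // ts.
  by rewrite mule0 (_ : t = s) ?subrr ?mulr0//; apply/le_anti/andP.
rewrite -!lenE; apply/andP; split; apply: ge0_le_integral => //.
- by move=> u _; rewrite lee_fin mulr_ge0 ?normal_peak_ge0 ?expR_ge0.
- apply/measurable_EFinP/measurable_funTS; exact: measurable_normal_pdf.
- move=> u /=; rewrite in_itv/= => /andP[su ut]; rewrite lee_fin normal_pdfE ?oner_eq0//.
  rewrite ler_wpM2l ?normal_peak_ge0// /normal_fun ler_expR subr0 expr1n.
  rewrite mulNr lerN2 -mulr_natr mul1r ler_pM2r ?invr_gt0//.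
  by rewrite ler_sqr ?nnegrE ?(le_trans s0)// ltW.
- by move=> u _; rewrite lee_fin normal_pdf_ge0.
- apply/measurable_EFinP/measurable_funTS; exact: measurable_normal_pdf.
- by move=> u _; rewrite lee_fin normal_pdf_ub ?oner_eq0.
Qed.

(** Both functions take values in [0, 1], so the set under [sup] is bounded by 1 and [sup] is a
    genuine upper bound. *)
Lemma Delta_ub (mu : law R) n t : Bn mu n = 1 ->
  (forall s, 0 <= cdf_lt mu n s <= 1) -> `|cdf_lt mu n t - Phi t| <= Delta mu n.
Proof.
move=> B1 cdf01; apply: ub_le_sup; last by exists t => //; rewrite B1 mulr1.
exists 1 => _ [s _ <-].
have /andP[c0 c1] := cdf01 (s * Bn mu n); have /andP[p0 p1] := Phi_itv s.
by rewrite ler_norml; apply/andP; split; lra.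
Qed.

End NormalCdf.

(** * Lower bounds for Delta_n from a jump and from a lattice *)

Section DiscreteDelta.
Variables (R : realType) (m : nat) (w : nat -> {nonneg R}) (x : nat -> R).
Hypothesis sum_w : \sum_(i < m) (w i)%:num = 1.
Local Notation mu := (discrete_prob x sum_w).
Variable n : nat.
Hypothesis B1 : Bn mu n = 1.

Let cdf_near t : Phi t - Delta mu n <= cdf_lt mu n t <= Phi t + Delta mu n.
Proof.
have := Delta_ub t B1 (cdf_lt_discrete_itv x sum_w n).
by rewrite ler_norml => /andP[a b]; apply/andP; split; lra.
Qed.

(** Across its jump at 0 the distribution function stays within Delta_n of Phi, which is continuous,
    so the jump is at most 2 Delta_n. *)
Lemma Delta_jump (j : 'I_m) : x j = 0 -> (w j)%:num ^+ n <= 2 * Delta mu n.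
Proof.
move=> xj0; apply/ler_addgt0Pr => e e0.
have K0 : 0 < normal_peak (1 : R) by rewrite normal_peak_gt0// oner_eq0.
(* Over an interval of this length Phi grows by at most e. *)
have t0 : 0 < e / normal_peak 1 by rewrite divr_gt0.
apply: (le_trans (cdf_lt_discrete_jump sum_w n xj0 t0)).
have /andP[_ c1] := cdf_near (e / normal_peak 1).
have /andP[c2 _] := cdf_near 0.
have /andP[_] := PhiB_bounds (lexx 0) (ltW t0).
by rewrite subr0 mulrCA divff ?gt_eqF// mulr1 => ?; lra.
Qed.

(** The distribution function is flat on ]0, b] while Phi increases there; the two ends of the cell
    share the discrepancy, whence the factor 2. *)
Lemma Delta_lattice (b : R) (z : nat -> int) : 0 < b ->
  (forall i, (i < m)%N -> x i = (z i)%:~R * b) ->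
  normal_peak 1 * expR (- (b ^+ 2 / 2)) * b <= 2 * Delta mu n.
Proof.
move=> b0 xz; apply/ler_addgt0Pr => e e0.
set K := normal_peak 1 * _.
have K0 : 0 < K by rewrite mulr_gt0 ?expR_gt0 ?normal_peak_gt0 ?oner_eq0.
(* The left end 0 is not in the cell; t stands in for it at a cost of K t <= e. *)
pose t := Num.min b (e / K).
have t0 : 0 < t by rewrite lt_min b0 divr_gt0.
have tb : t <= b by rewrite ge_min lexx.
have Kt : K * t <= e by rewrite mulrC -ler_pdivlMr// ge_min lexx orbT.
have /andP[c1 _] := cdf_near b; have /andP[_ c2] := cdf_near t.
have cE : cdf_lt mu n t = cdf_lt mu n b.
  by apply: (cdf_lt_discrete_lattice sum_w n b0 xz (q := 0));
    rewrite ?mul0r ?add0r ?mul1r.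
have /andP[+ _] := PhiB_bounds (ltW t0) tb.
rewrite -/K mulrBr => ?; move: c1 c2; rewrite cE; lra.
Qed.

End DiscreteDelta.

Lemma in_setb (T : Type) (P : T -> bool) (t : T) : (t \in [set u | P u]) = P t.
Proof. by apply/idP/idP; rewrite in_setE. Qed.

Lemma measurable_norm_lt (R : realType) (z : R) : measurable [set u : R | `|u| < z].
Proof.
rewrite (_ : [set _ | _] = `]- z, z[%classic)//.
by apply/seteqP; split => u; rewrite /= in_itv/= ltr_norml.
Qed.

Lemma measurable_norm_ge (R : realType) (z : R) : measurable [set u : R | z <= `|u|].
Proof.
rewrite (_ : [set _ | _] = ~` [set u | `|u| < z]); last first.
  by apply/seteqP; split => u /=; rewrite leNgt => /negP.
by apply: measurableC; exact: measurable_norm_lt.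
Qed.

(** * Symmetric laws with at most five atoms, normalised by B_n = 1 *)

Section SymmetricLaw.
Variables (R : realType) (n : nat) (b1 b2 v1 v2 : R).
Hypotheses (b1_gt0 : 0 < b1) (b2_gt0 : 0 < b2) (v1_gt0 : 0 < v1) (v2_ge0 : 0 <= v2).
Hypothesis v12 : v1 + v2 = 1.
Hypothesis n_gt0 : (0 < n)%N.
(** This is n P(X_1 <> 0), so [rate_le] says that the mass left for the atom 0 is nonnegative. *)
Let rate := v1 / b1 ^+ 2 + v2 / b2 ^+ 2.
Hypothesis rate_le : rate <= n%:R.

Let n0 : (0 : R) < n%:R. Proof. by rewrite ltr0n. Qed.

(* The masses of each of +-b1 and +-b2, chosen so that B_n = 1 and that the
   two pairs carry the fractions v1 and v2 of the variance. *)
Let q1 : R := v1 / (2 * n%:R * b1 ^+ 2).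
Let q2 : R := v2 / (2 * n%:R * b2 ^+ 2).

Let q1_gt0 : 0 < q1. Proof. by rewrite divr_gt0 ?mulr_gt0 ?exprn_gt0. Qed.
Let q2_ge0 : 0 <= q2.
Proof. by rewrite divr_ge0 ?mulr_ge0 ?exprn_ge0 ?(ltW b2_gt0) ?(ltW n0). Qed.

Let q0E : 1 - 2 * q1 - 2 * q2 = 1 - rate / n%:R.
Proof. by rewrite /q1 /q2 /rate; field; rewrite !gt_eqF. Qed.

Let q0_ge0 : 0 <= 1 - 2 * q1 - 2 * q2.
Proof. by rewrite q0E subr_ge0 ler_pdivrMr// mul1r. Qed.

Let w (i : nat) : {nonneg R} :=
  nth 0%:nng [:: NngNum q0_ge0; NngNum (ltW q1_gt0); NngNum (ltW q1_gt0);
                 NngNum q2_ge0; NngNum q2_ge0] i.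
Let x (i : nat) : R := nth 0 [:: 0; b1; - b1; b2; - b2] i.

Let sumE (F : R -> R) : \sum_(i < 5) (w i)%:num * F (x i) =
  (1 - 2 * q1 - 2 * q2) * F 0 + q1 * (F b1 + F (- b1)) + q2 * (F b2 + F (- b2)).
Proof. by rewrite !big_ord_recl big_ord0 /=; ring. Qed.

Let sum_w : \sum_(i < 5) (w i)%:num = 1.
Proof.
transitivity (\sum_(i < 5) (w i)%:num * (cst 1 (x i))).
  by apply: eq_bigr => i _; rewrite mulr1.
by rewrite sumE /=; ring.
Qed.

Definition sym_law : law R := discrete_prob x sum_w.

Let sym_law_second_moment : second_moment sym_law = (n%:R^-1)%:E.
Proof.
rewrite /second_moment integral_discrete//.
rewrite (sumE (fun t => t ^+ 2)); congr EFin.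
rewrite /q1 /q2 (_ : v2 = 1 - v1); last by rewrite -v12; ring.
by field; rewrite !gt_eqF.
Qed.

Lemma sym_law_in_F : in_F sym_law.
Proof.
split; [|split].
- move=> [a]; rewrite /sym_law /= discrete_law1.
  pose F t : R := (t == a)%:R; rewrite (sumE F) => -[].
  have F1 t : F t <= 1 by rewrite /F; case: eqP.
  (* Since b1 and - b1 differ, a single point misses one of them, so its mass is at most 1 - q1 <
     1. *)
  have F2 : F b1 + F (- b1) <= 1.
    rewrite /F; case: eqP => [<-|_]; last by case: eqP; rewrite add0r.
    by rewrite (lt_eqF (x := - b1)) ?addr0//; move: b1_gt0; lra.
  have := ler_wpM2l q0_ge0 (F1 0); have := ler_wpM2l (ltW q1_gt0) F2.
  have := ler_wpM2l q2_ge0 (lerD (F1 b2) (F1 (- b2))).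
  by move: q1_gt0; lra.
- by apply: (integrable_discrete _ _ _ (f := fun t => t ^+ 2)); exact: exprn_measurable.
- rewrite /mean integral_discrete// (sumE id); congr EFin; ring.
Qed.

Lemma sym_law_Bn : Bn sym_law n = 1.
Proof.
by rewrite /Bn /sigma1sq sym_law_second_moment/= divff ?sqrtr1// gt_eqF.
Qed.

Lemma sym_law_Mn (z : R) : Mn sym_law n z = 0.
Proof.
rewrite /Mn /mu1 sym_law_Bn mulr1 Rintegral_discrete//; last exact: measurable_norm_lt.
(* The truncated cube is odd: opposite atoms cancel, and its value at 0 vanishes. *)
have odd t : patch (fun=> 0) [set u : R | `|u| < z] (fun u => u ^+ 3) (- t) =
    - patch (fun=> 0) [set u : R | `|u| < z] (fun u => u ^+ 3) t.
  by rewrite /patch !in_setb normrN; case: ifP; rewrite ?oppr0// => _; ring.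
rewrite (sumE (patch _ _ _)) !odd !subrr -[X in patch _ _ _ X]oppr0.
have := odd 0; rewrite oppr0 => ?; rewrite (_ : patch _ _ _ 0 = 0); last lra.
by ring.
Qed.

Lemma sym_law_Ln (z : R) : 0 < z ->
  Ln sym_law n z = v1 * (z <= b1)%R%:R + v2 * (z <= b2)%R%:R.
Proof.
move=> z0; rewrite /Ln /sigma1sq_tail sym_law_Bn mulr1.
rewrite Rintegral_discrete//; last exact: measurable_norm_ge.
have tailE t : patch (fun=> 0) [set u : R | z <= `|u|] (fun u => u ^+ 2) t =
    t ^+ 2 * (z <= `|t|)%R%:R.
  by rewrite /patch !in_setb; case: ifP; rewrite ?mulr1 ?mulr0.
rewrite (sumE (patch _ _ _)) !tailE !normrN (gtr0_norm b1_gt0) (gtr0_norm b2_gt0).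
by rewrite /q1 /q2; field; rewrite !gt_eqF.
Qed.

Lemma sym_law_Delta_jump : (1 - rate / n%:R) ^+ n <= 2 * Delta sym_law n.
Proof.
by rewrite -q0E; exact: (Delta_jump sym_law_Bn (j := ord0) erefl).
Qed.

Lemma sym_law_Delta_lattice : b1 = b2 ->
  normal_peak 1 * expR (- (b1 ^+ 2 / 2)) * b1 <= 2 * Delta sym_law n.
Proof.
move=> b12.
(* When b1 = b2 the two pairs coincide, and the atoms are 0, b1 and - b1. *)
apply: (Delta_lattice sym_law_Bn (z := nth 0 [:: 0; 1; -1; 1; -1])) => //.
by do 5?[case] => //= _; rewrite ?mul0r ?mul1r ?mulN1r// /x/= b12.
Qed.

End SymmetricLaw.

(** * Bounds on M_n and L_n for a general law of the class *)

Section Fractions.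
Variables (R : realType) (mu : law R) (n : nat).
Hypotheses (muF : in_F mu) (n_gt0 : (0 < n)%N).

Let n0 : (0 : R) < n%:R. Proof. by rewrite ltr0n. Qed.

Let sqr_integrable (A : set R) : measurable A ->
  mu.-integrable A (EFin \o (fun u : R => u ^+ 2)).
Proof. by move=> mA; apply: integrableS muF.2.1. Qed.

Let sigma1sqE : sigma1sq mu = Rintegral mu setT (fun u => u ^+ 2).
Proof. by []. Qed.

Lemma sigma1sq_gt0 : 0 < sigma1sq mu.
Proof.
rewrite lt_def sigma1sqE Rintegral_ge0 ?andbT; last by move=> u _; exact: sqr_ge0.
apply/eqP => sigma0; have [nd [sqi _]] := muF; apply: nd; exists 0.
have int0 : (\int[mu]_u (u ^+ 2)%:E = 0)%E.
  by rewrite -[LHS]fineK ?[fine _]sigma0//; exact: integrable_fin_num sqi.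
have /integrableP[msq _] := sqi.
have [+ _] := ae_eq_integral_abs mu (@measurableT _ R) msq.
under eq_integral do rewrite abse_EFin ger0_norm ?sqr_ge0//.
(* A null set covers the points where u^2 is nonzero, so {0} would have mass 1, against
   non-degeneracy. *)
move=> /(_ int0) [A [mA A0 subA]].
have m0 : measurable [set (0 : R)] by exact: measurable_set1.
have C0 : mu (~` [set 0]) = 0%E.
  apply/eqP; rewrite -measure_le0 -A0; apply: le_measure; rewrite ?inE//.
    exact: measurableC.
  move=> u /= u0; apply: subA => /= /(_ I) [/eqP]; rewrite sqrf_eq0 => /eqP.
  exact: u0.
by rewrite -[[set 0]]setCK probability_setC ?C0 ?sube0//; exact: measurableC.
Qed.

Lemma Bn_gt0 : 0 < Bn mu n.
Proof. by rewrite sqrtr_gt0 mulr_gt0// sigma1sq_gt0. Qed.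

Let Bn2 : Bn mu n ^+ 2 = n%:R * sigma1sq mu.
Proof. by rewrite sqr_sqrtr// mulr_ge0 ?(ltW n0)// ltW// sigma1sq_gt0. Qed.

Let sigma1sq_split (c : R) : sigma1sq mu =
  Rintegral mu [set u | `|u| < c] (fun u => u ^+ 2) + sigma1sq_tail mu c.
Proof.
have cover : [set: R] = [set u | `|u| < c] `|` [set u | c <= `|u|].
  by apply/seteqP; split => // u _ /=; case: ltP; [left|right].
rewrite sigma1sqE cover Rintegral_setU//.
- exact: measurable_norm_lt.
- exact: measurable_norm_ge.
- by rewrite -cover; exact: sqr_integrable.
- by apply/disj_set2P; rewrite -subset0 => u /= []; rewrite ltNge => /negP.
Qed.

Lemma Ln_itv (z : R) : 0 <= Ln mu n z <= 1.
Proof.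
have B2 : 0 < Bn mu n ^+ 2 by rewrite exprn_gt0// Bn_gt0.
have tail0 : 0 <= sigma1sq_tail mu (z * Bn mu n).
  by apply: Rintegral_ge0 => u _; exact: sqr_ge0.
rewrite /Ln mulr_ge0 ?divr_ge0 ?(ltW n0) ?(ltW B2)//=.
rewrite mulrAC ler_pdivrMr// mul1r Bn2 ler_wpM2l ?(ltW n0)//.
rewrite [leRHS](sigma1sq_split (z * Bn mu n)) lerDr.
by apply: Rintegral_ge0 => u _; exact: sqr_ge0.
Qed.

(** On |u| < z B_n the cube is at most z B_n u^2 in absolute value, and n sigma_1^2 = B_n^2 absorbs
    the normalisation. *)
Lemma Mn_le (z : R) : 0 < z -> `|Mn mu n z| <= z.
Proof.
move=> z0; have B0 := Bn_gt0; set c := z * Bn mu n; have c0 : 0 < c by rewrite mulr_gt0.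
have mc := measurable_norm_lt (c : R).
have cube_le (u : R) : [set u | `|u| < c] u -> `|u ^+ 3| <= c * u ^+ 2.
  move=> /= uc; rewrite exprS normrM (ger0_norm (sqr_ge0 _)).
  by rewrite ler_wpM2r ?sqr_ge0// ltW.
have icsq : mu.-integrable [set u | `|u| < c] (EFin \o (fun u => c * u ^+ 2)).
  rewrite (_ : EFin \o _ = fun u => (c%:E * (u ^+ 2)%:E)%E); last exact/funext.
  by apply: integrableZl => //; exact: sqr_integrable.
have icube : mu.-integrable [set u | `|u| < c] (EFin \o (fun u : R => u ^+ 3)).
  apply: (le_integrable mc _ _ icsq).
    by apply/measurable_EFinP/measurable_funTS; exact: exprn_measurable.
  move=> u uc /=; rewrite lee_fin (ger0_norm (x := c * _)) ?cube_le//.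
  by rewrite mulr_ge0 ?sqr_ge0 ?ltW.
have mu1_le : `|mu1 mu c| <= c * sigma1sq mu.
  apply: (le_trans (le_normr_Rintegral mc icube)).
  apply: (@le_trans _ _ (Rintegral mu [set u | `|u| < c] (fun u => c * u ^+ 2))).
    apply: le_Rintegral => //.
    rewrite (_ : EFin \o _ = abse \o (EFin \o (fun u : R => u ^+ 3)))//.
    exact: integrable_abse.
  rewrite RintegralZl//; last exact: sqr_integrable.
  rewrite ler_wpM2l ?(ltW c0)// (sigma1sq_split c) lerDl.
  by apply: Rintegral_ge0 => u _; exact: sqr_ge0.
rewrite /Mn normrM ger0_norm ?divr_ge0 ?exprn_ge0 ?(ltW n0) ?(ltW B0)//.
apply: (le_trans (ler_wpM2l _ mu1_le)).
  by rewrite divr_ge0 ?exprn_ge0 ?(ltW n0) ?(ltW B0).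
have -> : n%:R / Bn mu n ^+ 3 * (c * sigma1sq mu) =
    z * (n%:R * sigma1sq mu) / Bn mu n ^+ 2.
  by rewrite /c; field; rewrite gt_eqF.
by rewrite -Bn2 mulfK// expf_neq0// gt_eqF.
Qed.

(** With z <= 1 / (n+1) the level c = z B_n satisfies c^2 < sigma_1^2, while the part of the second
    moment below c is at most c^2; hence some remains in the tail. *)
Lemma Ln_gt0_near0 (eps : R) : 0 < eps -> exists2 z, 0 < z < eps & 0 < Ln mu n z.
Proof.
move=> eps0; pose z := Num.min (eps / 2) (n.+1%:R^-1).
have z0 : 0 < z by rewrite lt_min divr_gt0//= invr_gt0 ltr0n.
have z1 : z * n.+1%:R <= 1.
  by rewrite -ler_pdivlMr ?ltr0n// mul1r ge_min lexx orbT.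
have ze : z < eps by rewrite gt_min; apply/orP; left; lra.
exists z; first by rewrite z0.
set c := z * Bn mu n; have s0 := sigma1sq_gt0.
have c2 : c ^+ 2 < sigma1sq mu.
  rewrite exprMn Bn2 mulrA -[ltRHS]mul1r ltr_pM2r//.
  move: z1 n0; rewrite -natr1; nra.
have low : Rintegral mu [set u | `|u| < c] (fun u => u ^+ 2) <= c ^+ 2.
  have mc := measurable_norm_lt (c : R).
  apply: (@le_trans _ _ (Rintegral mu [set u | `|u| < c] (fun=> c ^+ 2))).
    apply: le_Rintegral => //; first exact: sqr_integrable.
      by apply: (finite_measure_integrable_cst mu (c ^+ 2)).
    move=> u /= uc; rewrite -[leLHS]real_normK ?num_real//.
    by rewrite lerXn2r ?nnegrE ?normr_ge0// ltW// (le_lt_trans _ uc).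
  rewrite Rintegral_cst// ler_piMr ?sqr_ge0// -lee_fin fineK ?fin_num_measure//.
  exact: probability_le1.
rewrite /Ln mulr_gt0 ?divr_gt0 ?exprn_gt0 ?Bn_gt0//.
by have := sigma1sq_split c; rewrite -/c; lra.
Qed.

End Fractions.

(** The constant C keeps the second image bounded, without which its [sup] would be a default
    value. *)
Lemma sup_image_le (R : realType) (A : set R) (F F' : R -> R) (C : R) : A !=set0 ->
  (forall z, A z -> F z <= F' z <= C) -> sup (F @` A) <= sup (F' @` A).
Proof.
move=> [a Aa] FF'; apply: ge_sup; first by exists (F a), a.
move=> _ [z Az <-]; have /andP[le1 _] := FF' _ Az; apply: (le_trans le1).
apply: ub_le_sup; last by exists z.
by exists C => _ [u Au <-]; have /andP[] := FF' _ Au.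
Qed.

(** * Monotonicity of the fractions in the ratio g (z B_n) / g B_n *)

Section CompareWeights.
Variables (R : realType) (mu : law R) (n : nat).
Hypotheses (muF : in_F mu) (n_gt0 : (0 < n)%N).
Variables (eps gam : R).
Hypotheses (eps0 : 0 < eps) (gam0 : 0 < gam).
Local Notation B := (Bn mu n).

(** Moving the factor 1 / z here writes L_E as the supremum of the ratio of g times a bounded
    nonnegative function, the same shape as the supremum in L_R. *)
Let EssW z : R := (gam * `|Mn mu n z| + z * Ln mu n z) / z.

Let EssW_bounds z : 0 < z -> Ln mu n z <= EssW z <= gam + 1.
Proof.
move=> z0; have /andP[l0 l1] := Ln_itv muF n_gt0 z; have mz := Mn_le muF n_gt0 z0.
rewrite /EssW ler_pdivlMr// ler_pdivrMr// (mulrC (Ln _ _ _)) lerDr.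
rewrite mulr_ge0 ?(ltW gam0)//= mulrDl lerD//; first by rewrite ler_wpM2l// ltW.
by rewrite mulrC ler_wpM2r// ltW.
Qed.

Let L_EE g : L_E mu n g eps gam =
  sup [set g (z * B) / g B * EssW z | z in `]0, eps[].
Proof.
rewrite /L_E; congr sup; apply: eq_imagel => z /=; rewrite in_itv/= => /andP[z0 _].
by rewrite /EssW invfM; ring.
Qed.

Let itv_nonempty : (`]0, eps[%classic : set R) !=set0.
Proof.
exists (eps / 2).
by rewrite /= in_itv/= divr_gt0//= ltr_pdivrMr// ltr_pMr// ltr1n.
Qed.

Lemma Lfrac_le k (g g' : R -> R) :
  (forall z, 0 < z -> 0 <= g (z * B) / g B <= g' (z * B) / g' B) ->
  (forall z, 0 < z -> g' (z * B) / g' B <= Num.max z 1) ->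
  Lfrac k mu n g eps gam <= Lfrac k mu n g' eps gam.
Proof.
move=> gg' g'1.
have sup_le (h : R -> R) (C : R) : 0 <= C -> (forall z, 0 < z -> 0 <= h z <= C) ->
    sup [set g (z * B) / g B * h z | z in `]0, eps[] <=
    sup [set g' (z * B) / g' B * h z | z in `]0, eps[].
  move=> C0 hC; apply: (sup_image_le (C := (eps + 1) * C)) => // z.
  rewrite /= in_itv/= => /andP[z0 ze].
  have /andP[g0 gz] := gg' _ z0; have /andP[h0 hz] := hC _ z0.
  rewrite ler_wpM2r//= ler_pM ?(le_trans g0 gz)// (le_trans (g'1 _ z0))//.
  by rewrite ge_max; apply/andP; split; lra.
have L01 z : 0 < z -> 0 <= Ln mu n z <= 1 by move=> _; exact: Ln_itv.
case: k; rewrite /Lfrac.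
  rewrite !L_EE (sup_le _ (gam + 1))//; first by rewrite addr_ge0// ltW.
  move=> z z0; have /andP[L0 _] := L01 _ z0.
  by have /andP[L1 ->] := EssW_bounds z0; rewrite (le_trans L0).
rewrite /L_R lerD ?(sup_le _ 1)// ler_wpM2r// ler_wpM2l ?(ltW gam0)//.
(* Setting 1 / eps aside leaves the comparison of the ratios at z = eps. *)
rewrite !invfM !mulrA -![_ / eps / _]mulrAC ler_wpM2r ?invr_ge0 ?(ltW eps0)//.
by have /andP[] := gg' _ eps0.
Qed.

(** The point given by [Ln_gt0_near0] contributes a positive value to the supremum. Positivity is
    what allows the fractions to be inverted in [Delta_div_le]. *)
Lemma Lfrac_gt0 k (g : R -> R) :
  (forall z, 0 < z -> 0 < g (z * B) / g B <= Num.max z 1) ->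
  0 < Lfrac k mu n g eps gam.
Proof.
move=> gpos; have [z /andP[z0 ze] Lz] := Ln_gt0_near0 muF n_gt0 eps0.
have sup_gt (h : R -> R) (C : R) : 0 < h z -> 0 <= C ->
    (forall z, 0 < z -> h z <= C) -> 0 < sup [set g (z * B) / g B * h z | z in `]0, eps[].
  move=> hz C0 hC; have /andP[gz _] := gpos _ z0.
  apply: (lt_le_trans (mulr_gt0 gz hz)); apply: ub_le_sup; last first.
    by exists z => //=; rewrite in_itv/= z0.
  exists ((eps + 1) * C) => _ [u /= + <-]; rewrite in_itv/= => /andP[u0 ue].
  have /andP[gu gu1] := gpos _ u0.
  apply: (@le_trans _ _ (g (u * B) / g B * C)); first by rewrite ler_wpM2l ?hC// ltW.
  rewrite ler_wpM2r// (le_trans gu1)// ge_max; apply/andP; split; lra.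
case: k; rewrite /Lfrac.
  rewrite L_EE (sup_gt _ (gam + 1))//.
  - by have /andP[L1 _] := EssW_bounds z0; exact: lt_le_trans L1.
  - by rewrite addr_ge0// ltW.
  - by move=> u u0; have /andP[] := EssW_bounds u0.
rewrite /L_R ltr_wpDl//; last first.
  by apply: (sup_gt _ 1) => // u _; have /andP[] := Ln_itv muF n_gt0 u.
rewrite mulr_ge0// mulr_ge0 ?(ltW gam0)// invfM mulrCA mulr_ge0 ?invr_ge0 ?(ltW eps0)//.
by have /andP[/ltW] := gpos _ eps0.
Qed.

Lemma Delta_ge0 : 0 <= Delta mu n.
Proof.
rewrite /Delta; set S := [set _ | _ in _].
have [hS|nS] := pselect (has_sup S); last by rewrite sup_out.
have ub : has_ubound S by case: hS.
by apply: (le_trans _ (ub_le_sup ub _)); last by exists 0.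
Qed.

Lemma Delta_div_le k (g g' : R -> R) :
  (forall z, 0 < z -> 0 < g (z * B) / g B <= g' (z * B) / g' B) ->
  (forall z, 0 < z -> g' (z * B) / g' B <= Num.max z 1) ->
  Delta mu n / Lfrac k mu n g' eps gam <= Delta mu n / Lfrac k mu n g eps gam.
Proof.
move=> gg' g'1; have g1 z : 0 < z -> 0 < g (z * B) / g B <= Num.max z 1.
  by move=> z0; have /andP[-> h] := gg' _ z0; rewrite (le_trans h) ?g'1.
have L0 := Lfrac_gt0 k g1.
have LL : Lfrac k mu n g eps gam <= Lfrac k mu n g' eps gam.
  by apply: Lfrac_le => // z z0; have /andP[/ltW -> ->] := gg' _ z0.
by rewrite ler_wpM2l ?Delta_ge0// lef_pV2// posrE (lt_le_trans L0).
Qed.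

End CompareWeights.

(** * The class G and its extremal elements *)

Section ClassG.
Variables (R : realType) (B : R).

(** For z <= 1 the upper bound is monotonicity of g and the lower one monotonicity of z / g z; for z
    >= 1 the roles are exchanged. *)
Lemma in_G_ratio (g : R -> R) (z : R) : in_G g -> 0 < B -> 0 < z ->
  Num.min z 1 <= g (z * B) / g B <= Num.max z 1.
Proof.
move=> [gle [gge0 [ggt0 gdiv]]] B0 z0; have zB0 : 0 < z * B by rewrite mulr_gt0.
have gB := ggt0 _ B0; have gzB := ggt0 _ zB0.
have B00 : B != 0 by rewrite gt_eqF.
rewrite ler_pdivlMr// ler_pdivrMr//.
have [z1|/ltW z1] := leP z 1.
  have zBB : z * B <= B by rewrite ler_piMl// ltW.
  have := gdiv _ _ zB0 zBB; rewrite ler_pdivrMr// mulrAC ler_pdivlMr// => h.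
  by rewrite mul1r -(ler_pM2l B0) mulrA (mulrC B) h gle// ltW.
have BzB : B <= z * B by rewrite ler_peMl// ltW.
have := gdiv _ _ B0 BzB; rewrite ler_pdivrMr// mulrAC ler_pdivlMr// => h.
by rewrite mul1r gle ?(ltW B0)//= -(ler_pM2l B0) [leRHS]mulrA (mulrC B z).
Qed.

Lemma in_G_min : 0 < B -> in_G (fun z : R => Num.min z B).
Proof.
move=> B0; split=> [x y x0 xy|]; first by rewrite le_min !ge_min xy lexx orbT.
split=> [z z0|]; first by rewrite le_min z0 ltW.
split=> [z z0|x y x0 xy]; first by rewrite lt_min z0.
have y0 := lt_le_trans x0 xy.
rewrite ler_pdivrMr ?lt_min ?x0// mulrAC ler_pdivlMr ?lt_min ?y0//.
by case: (leP x B); case: (leP y B) => ? ?; nra.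
Qed.

Lemma in_G_max : 0 <= B -> in_G (fun z : R => Num.max z B).
Proof.
move=> B0; split=> [x y x0 xy|]; first by rewrite ge_max !le_max xy lexx orbT.
split=> [z z0|]; first by rewrite le_max z0.
split=> [z z0|x y x0 xy]; first by rewrite lt_max z0.
have y0 := lt_le_trans x0 xy.
rewrite ler_pdivrMr ?lt_max ?x0// mulrAC ler_pdivlMr ?lt_max ?y0//.
by case: (leP x B); case: (leP y B) => ? ?; nra.
Qed.

Lemma min_ratio (z : R) : 0 < B -> Num.min (z * B) B / Num.min B B = Num.min z 1.
Proof.
move=> B0; rewrite minxx -{2}[B]mul1r -minr_pMl ?(ltW B0)//.
by rewrite mulfK// gt_eqF.
Qed.

Lemma max_ratio (z : R) : 0 < B -> Num.max (z * B) B / Num.max B B = Num.max z 1.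
Proof.
move=> B0; rewrite maxxx -{2}[B]mul1r -maxr_pMl ?(ltW B0)//.
by rewrite mulfK// gt_eqF.
Qed.

End ClassG.

(** * Comparison of upper limits *)

Section LimSup.
Variable R : realType.
Implicit Types (u v : (\bar R)^nat).
Local Open Scope ereal_scope.

(** Rank 0, where B_n = 0, is discarded by intersecting each neighbourhood of infinity with n >
    0. *)
Lemma le_limn_esup u v : (forall n, (0 < n)%N -> u n <= v n) ->
  limn_esup u <= limn_esup v.
Proof.
move=> uv; apply: le_ereal_inf_tmp => _ [V Voo <-].
apply: (@le_trans _ _ (ereal_sup (u @` (V `&` [set n | (0 < n)%N])))).
  apply: ereal_inf_lbound; exists (V `&` [set n | (0 < n)%N]) => //.
  by apply: filterI => //; exists 1%N.
apply: ge_ereal_sup => _ [n [Vn n0] <-]; apply: (le_trans (uv _ n0)).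
by apply: ereal_sup_ubound; exists n.
Qed.

Lemma limn_esup_ge u c : (forall N, exists2 n, (N <= n)%N & c <= u n) ->
  c <= limn_esup u.
Proof.
move=> uc; apply: le_ereal_inf_tmp => _ [V [N _ NV] <-].
have [n Nn cn] := uc N; apply: (le_trans cn).
by apply: ereal_sup_ubound; exists n => //; exact: NV.
Qed.

End LimSup.

(** * Extremality of g0 and g1, and lower bounds for the constants *)

Section Constants.
Variables (R : realType) (k : Lkind) (eps gam : R).
Hypotheses (eps0 : 0 < eps) (gam0 : 0 < gam).

Lemma C_up_le (g g' : gfam R) :
  (forall mu n (z : R), in_F mu -> (0 < n)%N -> 0 < z ->
     0 < g mu n (z * Bn mu n) / g mu n (Bn mu n) /\
     g mu n (z * Bn mu n) / g mu n (Bn mu n) <=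
       g' mu n (z * Bn mu n) / g' mu n (Bn mu n) <= Num.max z 1) ->
  (C_up k g' eps gam <= C_up k g eps gam)%E.
Proof.
move=> gg'; apply: le_limn_esup => n n0; apply: ge_ereal_sup => _ [mu muF <-].
apply: (@le_trans _ _ (Delta mu n / Lfrac k mu n (g mu n) eps gam)%:E).
  rewrite lee_fin; apply: Delta_div_le => // z z0.
    by have [-> /andP[-> _]] := gg' _ _ _ muF n0 z0.
  by have [_ /andP[_ ->]] := gg' _ _ _ muF n0 z0.
by apply: ereal_sup_ubound; exists mu.
Qed.

Lemma C_cond_le_up (g : gfam R) : (C_cond k g eps gam <= C_up k g eps gam)%E.
Proof.
apply: ge_ereal_sup => _ [l l0 <-]; apply: le_limn_esup => n n0.
apply: ge_ereal_sup => _ [mu [muF Ll] <-]; apply: ereal_sup_ubound.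
by exists mu => //; rewrite Ll.
Qed.

Lemma supG_eq : supG k eps gam = C_up k (@g0 R) eps gam.
Proof.
apply/eqP; rewrite eq_le; apply/andP; split.
  apply: ge_ereal_sup => _ [g gG <-]; apply: C_up_le => mu n z muF n0 z0.
  have B0 := Bn_gt0 muF n0; rewrite /g0 min_ratio// lt_min z0 ltr01.
  by split=> //; exact: in_G_ratio.
(* g0 vanishes identically, so is not in G, for the degenerate laws with B_n = 0. *)
pose g mu n := if 0 < Bn mu n then g0 mu n else (fun z : R => Num.max z 0).
apply: (@le_trans _ _ (C_up k g eps gam)); last first.
  apply: ereal_sup_ubound; exists g => // mu n; rewrite /g; case: ifP => B0.
    exact: in_G_min.
  exact: in_G_max.
apply: C_up_le => mu n z muF n0 z0; have B0 := Bn_gt0 muF n0.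
rewrite /g B0 /g0 min_ratio// lt_min z0 ltr01 lexx/=.
by rewrite ge_min le_max lexx.
Qed.

Lemma infG_eq : infG k eps gam = C_up k (@g1 R) eps gam.
Proof.
apply/eqP; rewrite eq_le; apply/andP; split.
  apply: ereal_inf_lbound; exists (@g1 R) => // mu n.
  by apply: in_G_max; rewrite sqrtr_ge0.
apply: le_ereal_inf_tmp => _ [g gG <-]; apply: C_up_le => mu n z muF n0 z0.
have B0 := Bn_gt0 muF n0; rewrite /g1 max_ratio// lexx andbT.
have /andP[h1 ->] := in_G_ratio (gG mu n) B0 z0.
by rewrite (lt_le_trans _ h1)// lt_min z0 ltr01.
Qed.

Lemma C_at_ge (g : gfam R) (l c : R) :
  (forall N, exists2 n, (N <= n)%N & exists mu, [/\ in_F mu,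
     Lfrac k mu n (g mu n) eps gam = l & c <= Delta mu n / l]) ->
  (c%:E <= C_at k g eps gam l)%E.
Proof.
move=> H; apply: limn_esup_ge => N; have [n Nn [mu [muF Ll cl]]] := H N.
exists n => //; apply: (@le_trans _ _ (Delta mu n / l)%:E); first by rewrite lee_fin.
by apply: ereal_sup_ubound; exists mu.
Qed.

Lemma C_cond_ge (g : gfam R) (l : R) : 0 < l ->
  (C_at k g eps gam l <= C_cond k g eps gam)%E.
Proof. by move=> l0; apply: ereal_sup_ubound; exists l. Qed.

(** Once M_n vanishes and B_n = 1, the two kinds of fraction coincide. *)
Lemma Lfrac_sym (mu : law R) n (T G : R -> R) :
  Bn mu n = 1 -> (forall z, Mn mu n z = 0) -> (forall z, 0 < z -> Ln mu n z = T z) ->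
  G 1 = 1 -> Lfrac k mu n G eps gam = sup [set G z * T z | z in `]0, eps[].
Proof.
move=> B1 M0 LT G1; rewrite /Lfrac; case: k.
  rewrite /L_E; congr sup; apply: eq_imagel => z /=; rewrite in_itv/= => /andP[z0 _].
  rewrite B1 M0 LT// G1 mulr1 normr0; field; exact: lt0r_neq0.
rewrite /L_R M0 normr0 mulr0 add0r; congr sup.
apply: eq_imagel => z /=; rewrite in_itv/= => /andP[z0 _].
by rewrite B1 LT// G1 mulr1 divr1.
Qed.

Lemma sup_itv_eq (F : R -> R) (M : R) : (forall z, 0 < z < eps -> F z <= M) ->
  (forall e, 0 < e -> exists2 z, 0 < z < eps & M <= F z + e) ->
  sup [set F z | z in `]0, eps[] = M.
Proof.
move=> ub adh; apply/le_anti/andP; split.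
  apply: ge_sup; last by move=> _ [z /= + <-]; rewrite in_itv; exact: ub.
  by have [z z01 _] := adh _ ltr01; exists (F z), z; rewrite //= in_itv.
apply/ler_addgt0Pr => e e0; have [z z01 Mz] := adh _ e0.
apply: (le_trans Mz); rewrite lerD2r; apply: ub_le_sup.
  by exists M => _ [u /= + <-]; rewrite in_itv; exact: ub.
by exists z; rewrite //= in_itv.
Qed.

Lemma sup_itv_attained (F : R -> R) (z : R) : 0 < z < eps ->
  (forall u, 0 < u < eps -> F u <= F z) -> sup [set F z | z in `]0, eps[] = F z.
Proof.
by move=> z01 ub; apply: sup_itv_eq => // e e0; exists z => //; rewrite lerDl ltW.
Qed.

Lemma bernoulli_le (t : R) n : 0 <= t <= 1 -> 1 - n%:R * t <= (1 - t) ^+ n.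
Proof.
move=> /andP[t0 t1]; elim: n => [|n IH]; first by rewrite mul0r subr0 expr0.
rewrite exprS; have : 0 <= 1 - t by rewrite subr_ge0.
move=> /ler_wpM2l /(_ _ _ IH); apply: le_trans; rewrite -natr1.
have : (0 : R) <= n%:R by []. nra.
Qed.

(** Serves g0 and g1 alike, at the level l = G eps. Atoms at +-b with b >= eps give L_n = 1 on ]0,
    eps[, so the fraction is the supremum of G there, which is G eps by the Lipschitz condition; a
    large b puts nearly all the mass of S_n at 0. *)
Lemma C_cond_ge_max (g : gfam R) (G : R -> R) :
  (forall mu n, Bn mu n = 1 -> g mu n = G) -> G 1 = 1 -> 0 < G eps ->
  (forall s t, s <= t -> 0 <= G t - G s <= t - s) ->
  (((2 * G eps)^-1)%:E <= C_cond k g eps gam)%E.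
Proof.
move=> gG G1 l0 Glip; apply/lee_addgt0Pr => e e0.
rewrite -leeBlDr//; apply: le_trans (C_cond_ge _ l0).
rewrite -EFinB; set l := G eps; apply: C_at_ge => N; exists N.+1 => //.
have le0 : 0 < 2 * l * e by rewrite !mulr_gt0.
(* Then b >= max (1, c) gives 1 / b^2 <= 1 / c = 2 l e, a loss of at most e after division by 2
   l. *)
have [c c0 cE] : exists2 c : R, 0 < c & c * (2 * l * e) = 1.
  by exists (2 * l * e)^-1; rewrite ?invr_gt0// mulVf// gt_eqF.
pose b : R := eps + 1 + c.
have b1 : 1 <= b by rewrite /b; move: eps0; lra.
have b0 : 0 < b by lra.
have b_eps : eps <= b by rewrite /b; lra.
have rate1 : 1 / b ^+ 2 + 0 / b ^+ 2 <= N.+1%:R :> R.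
  rewrite mul0r addr0 (@le_trans _ _ 1) ?ler1n//.
  by rewrite ler_pdivrMr ?exprn_gt0// mul1r exprn_ege1.
have v10 : (0 : R) < 1 by [].
have v20 : (0 : R) <= 0 by [].
have v12 : 1 + 0 = 1 :> R by rewrite addr0.
pose mu := sym_law b0 b0 v10 v20 (ltn0Sn N) rate1.
have B1 : Bn mu N.+1 = 1 by exact: sym_law_Bn.
exists mu; split; first exact: sym_law_in_F.
  rewrite gG// (Lfrac_sym (T := fun z => 1 * (z <= b)%R%:R + 0 * (z <= b)%R%:R))//.
  - apply: sup_itv_eq => [z /andP[z0 ze]|d d0].
      have -> : z <= b by apply: le_trans b_eps; exact: ltW.
      rewrite mul0r addr0 !mulr1 -subr_ge0; by have /andP[] := Glip _ _ (ltW ze).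
    (* The interval is open at eps, so the supremum is only approached, here to within d. *)
    pose z := Num.max (eps / 2) (eps - d).
    have ze : z < eps by rewrite gt_max; apply/andP; split; move: eps0; lra.
    exists z; first by rewrite ze lt_max divr_gt0.
    have -> : z <= b by apply: le_trans b_eps; exact: ltW.
    have /andP[_] := Glip _ _ (ltW ze); have : eps - d <= z by rewrite le_max lexx orbT.
    by rewrite mul0r addr0 !mulr1 -/l; lra.
  - by move=> z; exact: sym_law_Mn.
  - by move=> z; exact: sym_law_Ln.
rewrite ler_pdivlMr//.
have := sym_law_Delta_jump b0 b0 v10 v20 v12 (ltn0Sn N) rate1.
rewrite -/mu; set r := 1 / b ^+ 2 + _ => jump.
have rb : r <= (2 * l * e).
  rewrite /r mul0r addr0 ler_pdivrMr ?exprn_gt0// -[leLHS]cE mulrC ler_wpM2l ?(ltW le0)//.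
  have : b <= b ^+ 2 by rewrite expr2 ler_peMl// ltW.
  by apply: le_trans; rewrite /b; move: eps0; lra.
have r0 : 0 <= r by rewrite /r mul0r addr0 divr_ge0// sqr_ge0.
have r01 : 0 <= r / N.+1%:R <= 1.
  by rewrite divr_ge0//= ler_pdivrMr ?ltr0n// mul1r.
have := le_trans (bernoulli_le N.+1 r01) jump.
rewrite mulrC divfK ?pnatr_eq0// mulrBl invfM mulfVK ?gt_eqF//.
lra.
Qed.

Lemma C_cond_g1_ge : (((11 / 16) ^+ 2 / 2)%:E <= C_cond k (@g1 R) eps gam)%E.
Proof.
(* The level is l = 1. An even n = 2m lets Bernoulli's inequality act on the exponent m and the
   result be squared: (11/16)^2 instead of the 3/8 obtained from exponent n directly. *)
apply: le_trans (C_cond_ge _ ltr01); apply: C_at_ge => N; exists (N.+1 * 2)%N.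
  by rewrite (leq_trans (leqnSn N))// leq_pmulr.
set n := (N.+1 * 2)%N.
have n0 : (0 < n)%N by [].
have b1 : (0 : R) < 1 by [].
have b2 : (0 : R) < 2 by [].
have v1 : (0 : R) < 1 / 2 by rewrite divr_gt0.
have v2 : (0 : R) <= 1 / 2 by exact: ltW.
have v12 : 1 / 2 + 1 / 2 = 1 :> R by field.
have rate : 1 / 2 / 1 ^+ 2 + 1 / 2 / 2 ^+ 2 <= n%:R :> R.
  by apply: (@le_trans _ _ 1); [lra|rewrite ler1n].
pose mu := sym_law b1 b2 v1 v2 n0 rate.
have B1 : Bn mu n = 1 by exact: sym_law_Bn.
exists mu; split; first exact: sym_law_in_F.
  have -> : g1 mu n = Num.max^~ 1 by apply/funext => z; rewrite /g1 B1.
  pose T (z : R) : R := 1 / 2 * (z <= 1)%R%:R + 1 / 2 * (z <= 2)%R%:R.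
  rewrite (Lfrac_sym (T := T)) ?maxxx//.
  - pose z := Num.min (eps / 2) 1.
    have z0 : 0 < z by rewrite lt_min divr_gt0.
    have z1 : z <= 1 by rewrite ge_min lexx orbT.
    have Fz : Num.max z 1 * T z = 1.
      by rewrite /T z1 (le_trans z1) ?ler1n// max_r// !mulr1 mul1r v12.
    rewrite -[RHS]Fz; apply: (sup_itv_attained (F := fun z => Num.max z 1 * T z)).
      by rewrite z0 gt_min; apply/orP; left; move: eps0; lra.
    (* The product is 1 up to 1, then u / 2 up to 2, then 0, hence at most 1 whatever eps is. *)
    move=> u /andP[u0 _]; rewrite Fz /T.
    by case: (leP u 1) => u1; case: (leP u 2) => u2 /=; lra.
  - by move=> z; exact: sym_law_Mn.
  - by move=> z; exact: sym_law_Ln.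
rewrite divr1 ler_pdivrMr// [leRHS]mulrC.
apply: le_trans (sym_law_Delta_jump b1 b2 v1 v2 v12 n0 rate).
have -> : (1 / 2 / 1 ^+ 2 + 1 / 2 / 2 ^+ 2) / n%:R = 5 / 16 / N.+1%:R :> R.
  have : N.+1%:R != 0 :> R by rewrite pnatr_eq0.
  by rewrite /n natrM; move: (N.+1%:R) => t t0; field.
have t01 : 0 <= (5 / 16 / N.+1%:R : R) <= 1.
  rewrite !divr_ge0//= ler_pdivrMr ?ltr0n// mul1r (@le_trans _ _ 1) ?ler1n//; lra.
have := bernoulli_le N.+1 t01.
rewrite mulrC divfK ?pnatr_eq0// => h.
rewrite /n exprM lerXn2r ?nnegrE ?divr_ge0//; last by apply: le_trans h; lra.
by rewrite exprn_ge0// subr_ge0; case/andP: t01.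
Qed.

Lemma C_low_g0_ge : ((normal_peak 1 / 2)%:E <= C_low k (@g0 R) eps gam)%E.
Proof.
apply: le_ereal_inf_tmp => _ [V V0 <-]; apply/lee_addgt0Pr => e e0.
have K0 : 0 < normal_peak (1 : R) by rewrite normal_peak_gt0// oner_eq0.
(* The upper limit is an infimum over neighbourhoods V of suprema, so one good level l in each V is
   enough. *)
have [d d0 dV] : exists2 d : R, 0 < d & forall l, 0 < l < d -> V l.
  move: V0 => [d /= d0 dV]; exists d => // l /andP[l0 ld]; apply: dV => //=.
  by rewrite sub0r normrN gtr0_norm.
(* In turn: l lies in V; z = l lies in ]0, eps[; min l 1 = l; and the error term is at most e. The
   atoms are +-l, so the fraction is attained at z = l and equals l. *)
pose l := Num.min (Num.min (d / 2) (eps / 2)) (Num.min 1 (e / normal_peak 1)).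
have l0 : 0 < l by rewrite !lt_min ltr01 !divr_gt0.
have ld : l < d by rewrite !gt_min; apply/orP; left; apply/orP; left; lra.
have le : l < eps by rewrite !gt_min; apply/orP; left; apply/orP; right; move: eps0; lra.
have l1 : l <= 1 by rewrite !ge_min lexx !orbT.
have Kl : normal_peak 1 * l <= e.
  by rewrite mulrC -ler_pdivlMr// !ge_min lexx !orbT.
rewrite -leeBlDr// -EFinB; apply: (@le_trans _ _ (C_at k (@g0 R) eps gam l)); last first.
  by apply: ereal_sup_ubound; exists l => //; apply: dV; rewrite l0.
(* Taking n >= 1 / l^2 leaves a nonnegative mass at 0. *)
apply: C_at_ge => N; pose n := maxn N.+1 (Num.bound (l ^- 2)); exists n.
  by rewrite leq_max leqnSn.
have n0 : (0 < n)%N by rewrite leq_max.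
have v1 : (0 : R) < 1 / 2 by rewrite divr_gt0.
have v2 : (0 : R) <= 1 / 2 by exact: ltW.
have v12 : 1 / 2 + 1 / 2 = 1 :> R by field.
have rate : 1 / 2 / l ^+ 2 + 1 / 2 / l ^+ 2 <= n%:R :> R.
  rewrite -mulrDl v12 mul1r; apply: (@le_trans _ _ (Num.bound (l ^- 2))%:R).
    by rewrite ltW// archi_boundP// invr_ge0 sqr_ge0.
  by rewrite ler_nat leq_maxr.
pose mu := sym_law l0 l0 v1 v2 n0 rate.
have B1 : Bn mu n = 1 by exact: sym_law_Bn.
exists mu; split; first exact: sym_law_in_F.
  have -> : g0 mu n = Num.min^~ 1 by apply/funext => z; rewrite /g0 B1.
  pose T (z : R) : R := 1 / 2 * (z <= l)%R%:R + 1 / 2 * (z <= l)%R%:R.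
  rewrite (Lfrac_sym (T := T)) ?minxx//.
  - have Fl : Num.min l 1 * T l = l by rewrite /T lexx !mulr1 v12 min_l// mulr1.
    rewrite -[RHS]Fl; apply: (sup_itv_attained (F := fun z => Num.min z 1 * T z)).
      by rewrite l0.
    move=> u /andP[u0 _]; rewrite Fl /T; case: (leP u l) => ul /=; last lra.
    by rewrite min_l; lra.
  - by move=> z; exact: sym_law_Mn.
  - by move=> z; exact: sym_law_Ln.
rewrite ler_pdivlMr//.
have := sym_law_Delta_lattice l0 l0 v1 v2 v12 n0 rate erefl.
rewrite -/mu; set E := expR _.
have : 1 - l <= E.
  apply: le_trans (expR_ge1Dx _); rewrite lerD2l lerN2.
  have : l ^+ 2 <= l by rewrite expr2 ler_piMl// ltW.
  have := sqr_ge0 l; lra.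
move=> /(ler_wpM2l (ltW (mulr_gt0 K0 l0))) /[swap] D1 D2.
have : normal_peak 1 * l * l <= e * l by rewrite ler_wpM2r// ltW.
have := mulr_ge0 (ltW e0) (ltW l0).
by move: D1 D2; rewrite -!mulrA [E * l]mulrC; lra.
Qed.

End Constants.

(** * The Bessel function bound and the conclusion *)

Lemma I0_le (R : realType) (t : R) : 0 <= t <= 1 -> I0 t <= 4 / 3.
Proof.
move=> /andP[t0 t1].
pose S N : R := \sum_(0 <= i < N) (t / 2) ^+ (2 * i) / (i`!)%:R ^+ 2.
rewrite -[I0 t]/(limn S).
have term_ge0 i : 0 <= (t / 2) ^+ (2 * i) / (i`!)%:R ^+ 2 :> R.
  by rewrite divr_ge0 ?exprn_ge0// divr_ge0.
have S_le N : S N <= 4 / 3.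
  (* The k-th term is at most (1/4)^k for t <= 1; the right side is the geometric partial sum, which
     the induction needs. *)
  suff : S N <= 4 / 3 - 4 / 3 * (1 / 4) ^+ N.
    by move=> h; apply: (le_trans h); rewrite lerBlDr lerDl mulr_ge0// exprn_ge0.
  rewrite /S; elim: N => [|N IH]; first by rewrite big_nil; lra.
  rewrite big_nat_recr//=; apply: (le_trans (lerD IH _)).
    apply: (@le_trans _ _ ((1 / 4) ^+ N)); last exact: lexx.
    rewrite ler_pdivrMr ?exprn_gt0 ?ltr0n ?fact_gt0// exprM.
    apply: (@le_trans _ _ ((1 / 4) ^+ N)).
      by rewrite lerXn2r ?nnegrE ?sqr_ge0//; nra.
    by rewrite ler_peMr ?exprn_ge0// exprn_ege1// ler1n fact_gt0.
  by rewrite exprS; lra.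
apply: limr_le; last by apply: nearW.
apply: nondecreasing_is_cvgn; last by exists (4 / 3) => _ [N _ <-].
apply/nondecreasing_seqP => N; rewrite /S big_nat_recr//= lerDl.
exact: term_ge0.
Qed.

Theorem theorem6 (R : realType) (k : Lkind) (eps gam : R) :
  0 < eps -> 0 < gam ->
  (((2 * Num.sqrt (2 * pi))^-1)%:E <= C_low k (@g0 R) eps gam)%E /\
      supG k eps gam = C_up k (@g0 R) eps gam /\
      (C_cond k (@g0 R) eps gam <= C_up k (@g0 R) eps gam)%E /\
      (((2 * Num.min eps 1)^-1)%:E <= C_cond k (@g0 R) eps gam)%E /\
      infG k eps gam = C_up k (@g1 R) eps gam /\
      (C_cond k (@g1 R) eps gam <= C_up k (@g1 R) eps gam)%E /\
      [/\ eps <= 1 -> ((1 / 2)%:E <= C_cond k (@g1 R) eps gam)%E,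
          1 < eps -> eps <= 11251%:R / 10000%:R ->
            ((expR (- eps ^-2) * I0 (eps ^-2) / 2)%:E
               <= C_cond k (@g1 R) eps gam)%E &
          11251%:R / 10000%:R <= eps ->
            ((2344%:R / 10000%:R)%:E <= C_cond k (@g1 R) eps gam)%E].
Proof.
move=> eps0 gam0.
have lip_min (s t : R) : s <= t -> 0 <= Num.min t 1 - Num.min s 1 <= t - s.
  by move=> st; case: (leP s 1); case: (leP t 1) => ? ?; apply/andP; split; lra.
have lip_max (s t : R) : s <= t -> 0 <= Num.max t 1 - Num.max s 1 <= t - s.
  by move=> st; case: (leP s 1); case: (leP t 1) => ? ?; apply/andP; split; lra.
(* This settles both cases with eps <= 1.1251. *)
have cond_max : (((2 * Num.max eps 1)^-1)%:E <= C_cond k (@g1 R) eps gam)%E.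
  apply: (C_cond_ge_max k gam eps0 (G := Num.max^~ 1)) => //; last by rewrite lt_max eps0.
    by move=> mu n B1; apply/funext => z; rewrite /g1 B1.
  exact: maxxx.
split; [|split; [|split; [|split; [|split; [|split; [|split]]]]]].
- have -> : (2 * Num.sqrt (2 * pi))^-1 = normal_peak 1 / 2 :> R.
    by rewrite /normal_peak expr1n mul1r -[pi *+ 2]mulr_natl invfM mulrC.
  exact: C_low_g0_ge.
- exact: supG_eq.
- exact: C_cond_le_up.
- apply: (C_cond_ge_max k gam eps0 (G := Num.min^~ 1)) => //; last by rewrite lt_min eps0/=.
    by move=> mu n B1; apply/funext => z; rewrite /g0 B1.
  exact: minxx.
- exact: infG_eq.
- exact: C_cond_le_up.
- by move=> eps1; move: cond_max; rewrite max_r// mulr1 div1r.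
- move=> eps1 eps2; apply: le_trans cond_max; rewrite lee_fin max_l ?(ltW eps1)//.
  (* The goal reduces to exp (- t) I0 t <= 1 / eps with t = eps^-2. Since exp (- t) <= 1 / (1 + t),
     I0 t <= 4/3 and t >= 2/3, the left side is at most 4/5, below 5/6 <= 1 / eps. *)
  have {}eps2 : eps <= 6 / 5.
    apply: (le_trans eps2); rewrite ler_pdivrMr ?ltr0n// mulrAC ler_pdivlMr ?ltr0n//.
    by rewrite -!natrM ler_nat.
  set t := eps ^-2; have te : t * eps ^+ 2 = 1.
    by rewrite /t mulVf// expf_neq0// gt_eqF.
  have t0 : 0 < t by rewrite invr_gt0 exprn_gt0.
  have t1 : t <= 1 by rewrite invf_le1 ?exprn_gt0// exprn_ege1// ltW.
  have t2 : 2 / 3 <= t by nra.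
  have I4 : I0 t <= 4 / 3 by rewrite I0_le// (ltW t0).
  have E1 : expR (- t) <= (1 + t)^-1.
    by rewrite expRN lef_pV2 ?posrE ?expR_gt0 ?expR_ge1Dx//; lra.
  have EI : expR (- t) * I0 t <= (1 + t)^-1 * (4 / 3).
    apply: (@le_trans _ _ (expR (- t) * (4 / 3))).
      by rewrite ler_wpM2l ?expR_ge0.
    by rewrite ler_wpM2r// divr_ge0.
  have step : (1 + t)^-1 * (4 / 3) <= eps^-1.
    rewrite mulrC ler_pdivrMr; last lra.
    by rewrite [leRHS]mulrC ler_pdivlMr//; nra.
  by rewrite invfM mulrC ler_wpM2l// (le_trans EI).
- move=> _; apply: le_trans (C_cond_g1_ge k gam eps0); rewrite lee_fin.
  lra.
Qed.
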